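(* Let $f:\mathbb{Z}\to\mathbb{C}$ be a multiplicative function. Suppose there exist integers $a,b>1$ and $d_1,d_2>1$ with $\gcd(a,d_1)=\gcd(b,d_2)=1$, $\gcd(d_1,d_2)=1$, $f(a)\neq 0$ and $f(b)\neq 0$, such that $$f(u_1+v_1)=f(u_1)+f(v_1)\quad\text{for all } u_1,v_1\in\mathcal{P}_{a,d_1}$$ and $$f(u_2+v_2)=f(u_2)+f(v_2)\quad\text{for all } u_2,v_2\in\mathcal{P}_{b,d_2}.$$ Then $f$ is the identity function $f(n)=n$.
   Context: A function $f:\mathbb{Z}\to\mathbb{C}$ is multiplicative if $f(mn)=f(m)f(n)$ whenever $\gcd(m,n)=1$. For integers $a,d$, $\mathcal{P}_{a,d}=\{a+kd : k\in\mathbb{Z}\}$. *)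

(* Defs.v *)
From HB Require Import structures.
From mathcomp Require Import all_boot all_order all_algebra.
From mathcomp Require Import classical_sets reals.
From mathcomp Require Import complex.

Set Implicit Arguments.
Unset Strict Implicit.
Unset Printing Implicit Defensive.

Import Order.TTheory GRing.Theory Num.Theory.

Local Open Scope classical_set_scope.
Local Open Scope ring_scope.

(* The domain is all of int: since gcd(0, n) = |n|, this also constrains f at
   0 and at negative arguments through n = 1 and n = -1. *)
Definition multiplicative (R : realType) (f : int -> R[i]) : Prop :=
  forall m n : int, coprimez m n -> f (m * n) = f m * f n.

Definition arith_prog (a d : int) : set int := [set a + k * d | k in [set: int]].

(* Main.v *)
Require Import Defs.
From HB Require Import structures.
From mathcomp Require Import all_boot all_order all_algebra.
From mathcomp Require Import cyclic.
From mathcomp Require Import classical_sets reals.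
From mathcomp Require Import complex.
From mathcomp Require Import zify ring.

(** Why the theorem holds.  On a progression the sum [f u + f v = f (u + v)]
    depends on [u + v] only, which forces [f] to be affine there, say
    [f (a + k d) = f a + c k].  Multiplying elements of the class of [a] by
    coprime elements of the class of [1] and comparing slopes gives a
    dichotomy ([id_or_const]): either [f] is the identity on the class of [1]
    modulo [d], or [f] is constant on the class of [a].

    The constant case does occur for a single even modulus: with [d = 2], the
    function with value 1 on odd and 2 on even integers is multiplicative and
    additive on odd integers.  It cannot occur for odd [d]
    ([const_modulus_even]): there [f] would be periodic on the integers prime
    to [d], so [f (2 ^ k)] would take finitely many values; but doubling an
    odd element of the class of [a] shows [f 2 = 2], whence
    [f (2 ^ k) = 2 ^ k].  Of two coprime moduli one is odd, so [f] is the
    identity on the class of [1] for that one; the constant case for the other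
    would make [f] equal to 1 on its class of [1], and the two classes have
    common elements other than [1] ([id_on_one_excludes_const]).

    Hence [f] is the identity on both classes of [1].  If [n] is prime to
    [d1], choose [m] prime to [n], inverse to [n] modulo [d1] and congruent to
    [1] modulo [d2]: then [m n = f (m n) = f m * f n = m * f n], so [f n = n]
    ([id_on_coprime]).  The same holds for [n] prime to [d2], and every nonzero
    integer is a product of two coprime factors, one prime to [d1] and the
    other prime to [d2].  Finally [f 0 = f 0 * f (-1) = - f 0]. *)

Set Implicit Arguments.
Unset Strict Implicit.
Unset Printing Implicit Defensive.

Import Order.TTheory GRing.Theory Num.Theory.

Local Open Scope classical_set_scope.
Local Open Scope ring_scope.

(** * Coprime representatives of residue classes *)

Lemma coprimez_cong (d m r : int) :
  (d %| m - r)%Z -> coprimez r d -> coprimez m d.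
Proof.
move=> /dvdzP[q e]; have -> : m = q * d + r by rewrite -e subrK.
by rewrite ![coprimez _ d]coprimez_sym /coprimez gcdzMDl.
Qed.

Lemma coprimez_gt1_neq0 (m d : int) : 1 < d -> coprimez m d -> m != 0.
Proof. by move=> d1; apply: contraTneq => ->; rewrite /coprimez gcd0z; lia. Qed.

Lemma crt (d e r s : int) : coprimez d e ->
  exists m : int, (d %| m - r)%Z /\ (e %| m - s)%Z.
Proof.
move=> co; exists (zchinese d e r s).
by split; rewrite -eqz_mod_dvd; apply/eqP;
  [apply: zchinese_modl | apply: zchinese_modr].
Qed.

Lemma inv_mod (n d : int) : coprimez n d ->
  exists2 m : int, (d %| m * n - 1)%Z & coprimez m d.
Proof.
move=> /coprimezP[[u v] /= e]; exists u.
  by apply/dvdzP; exists (- v); rewrite -e; ring.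
by apply/coprimezP; exists (n, v) => /=; rewrite -e; ring.
Qed.

(** [N1] is the part of [N] supported on the primes of [D]; the sign of [N] goes
    to [N2].  The last clause says that [N1] has no prime outside of [D]. *)
Lemma split_at_primes (D N : int) : 1 < D -> N != 0 ->
  exists N1 N2 : int, [/\ N = N1 * N2, coprimez N2 D, coprimez N1 N2 &
    forall m : int, coprimez m D -> coprimez m N1].
Proof.
move=> D1 N0; pose pi := \pi(absz D); pose n := absz N.
have n0 : (0 < n)%N by rewrite /n; lia.
have D0 : (0 < absz D)%N by lia.
exists (n`_pi)%N%:Z, (sgz N * (n`_pi^')%N%:Z); split.
- rewrite mulrCA -PoszM partnC // /n.
  by rewrite [LHS]intEsg.
- rewrite coprimezE abszM absz_sg N0 mul1n /= coprime_sym.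
  by rewrite coprime_pi' ?part_gt0 // part_pnat.
- by rewrite coprimezE abszM absz_sg N0 mul1n coprime_partC.
- move=> m co; have m0 := coprimez_gt1_neq0 D1 co.
  rewrite coprimezE coprime_sym /=; apply: (@pnat_coprime pi).
    exact: part_pnat.
  by rewrite -(coprime_pi' D0) ?absz_gt0 // coprime_sym.
Qed.

(** Primes of [N] that divide [D] are avoided because [r] is prime to [D]; the
    others are avoided by imposing [m = 1] modulo the part [N2] of [N] that is
    prime to [D].  This supplies the coprime arguments that multiplicativity
    asks for. *)
Lemma coprime_in_class (D r N : int) : 1 < D -> coprimez r D -> N != 0 ->
  exists2 m : int, (D %| m - r)%Z & coprimez m N.
Proof.
move=> D1 cor N0; have [N1 [N2 [-> co2 _ co1]]] := split_at_primes D1 N0.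
have coD2 : coprimez D N2 by rewrite coprimez_sym.
have [m [mD mN]] := crt r 1 coD2.
exists m => //; rewrite coprimezMr co1 ?(coprimez_cong mD) //=.
by apply: coprimez_cong mN _; rewrite /coprimez gcd1z.
Qed.

(** * Multiplicative functions additive on one progression *)

Section MultiplicativeFunction.

Variables (K : numFieldType) (f : int -> K).
Hypothesis f_mult : forall m n : int, coprimez m n -> f (m * n) = f m * f n.

Definition id_on_one (d : int) :=
  forall n : int, (d %| n - 1)%Z -> f n = n%:~R.
Definition const_on (a d : int) :=
  forall n : int, (d %| n - a)%Z -> f n = f a.

Section OneProgression.

Variables a d : int.
Hypotheses (d_gt1 : 1 < d) (co_ad : coprimez a d) (fa_neq0 : f a <> 0).
Hypothesis f_add : forall u v : int,
  (d %| u - a)%Z -> (d %| v - a)%Z -> f (u + v) = f u + f v.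

(** Additivity makes [f (a + k d) + f (a + l d)] a function of [k + l], so the
    increments [f (a + (k + 1) d) - f (a + k d)] are all equal. *)
Lemma affine_on_class :
  exists c : K, forall k : int, f (a + k * d) = f a + c * k%:~R.
Proof.
have in_class k : (d %| a + k * d - a)%Z by rewrite addrC addrA addNr add0r dvdz_mull.
pose h k := f (a + k * d).
have hS k : h (k + 1) = h k + (h 1 - h 0).
  have E : h (k + 1) + h 0 = h k + h 1.
    by rewrite /h -!f_add //; congr f; ring.
  by rewrite addrA -E addrK.
have h0 : h 0 = f a by rewrite /h mul0r addr0.
exists (h 1 - h 0) => k; rewrite -/(h k) -h0.
elim: k => [|n IH|n IH]; first by rewrite mulr0 addr0.
  by rewrite -addn1 PoszD hS IH intrD; ring.
apply: (@addIr _ (h 1 - h 0)); rewrite -hS.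
have -> : (- n.+1%:Z + 1 = - n%:Z) by lia.
rewrite IH -addn1 PoszD opprD intrD mulrDr mulrN1; ring.
Qed.

(** With [f (a + k d) = f a + c k], the constant case is [c = 0]. *)
Lemma id_or_const : id_on_one d \/ const_on a d.
Proof.
have [c fE] := affine_on_class.
have [c0|c0] := eqVneq c 0.
  right=> n /dvdzP[q e]; have -> : n = a + q * d by rewrite -e; ring.
  by rewrite fE c0 mul0r addr0.
left=> n nd.
have co_nd : coprimez n d.
  by apply: coprimez_cong nd _; rewrite /coprimez gcd1z.
have n0 := coprimez_gt1_neq0 d_gt1 co_nd.
have [m /dvdzP[k km] co_mn] := coprime_in_class d_gt1 co_ad n0.
case/dvdzP: nd => q qn.
have {}km : m = a + k * d by rewrite -km; ring.
have {}qn : n = 1 + q * d by rewrite -qn; ring.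

(* [m + d * n] is a second element of the class of [a] prime to [n], and
   multiplication by [n] preserves that class: the difference of the two
   products isolates the slope [c]. *)
have co_m'n : coprimez (m + d * n) n.
  apply: coprimez_cong co_mn; by rewrite addrC addrA addNr add0r dvdz_mull.
have mn : m * n = a + (k + q * m) * d.
  by rewrite mulrDl addrA -km {1}qn; ring.
have m'n : (m + d * n) * n = a + (k + q * m + d * n * q + n) * d.
  have -> : (m + d * n) * n = m * n + d * n * n by ring.
  by rewrite mn {2}qn; ring.
have e1 : f m * f n = f a + c * (k + q * m)%:~R by rewrite -f_mult // -fE mn.
have e2 : f (m + d * n) * f n = f a + c * (k + q * m + d * n * q + n)%:~R.
  by rewrite -f_mult // -fE m'n.
have fm : f m = f a + c * k%:~R by rewrite km fE.
have fm' : f (m + d * n) = f a + c * (k + n)%:~R.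
  by rewrite -fE km; congr f; ring.
have : (c * n%:~R) * (f n - n%:~R) = 0.
  have -> : (c * n%:~R) * (f n - n%:~R)
     = f (m + d * n) * f n - f m * f n - c * n%:~R * n%:~R.
    by rewrite fm fm' intrD; ring.
  rewrite e1 e2 !intrD !intrM.
  have -> : n%:~R = 1 + q%:~R * d%:~R :> K by rewrite qn intrD intrM.
  by ring.
move/eqP; rewrite mulf_eq0 mulf_eq0 (negPf c0) intr_eq0 (negPf n0) /=.
by rewrite subr_eq0 => /eqP.
Qed.

Hypothesis f_const : const_on a d.

(** Multiplication by [n] maps an element of the class of [a] prime to [n] to
    that class again, where [f] takes the nonzero value [f a] only. *)
Lemma const_one (n : int) : (d %| n - 1)%Z -> f n = 1.
Proof.
move=> nd; have co_nd : coprimez n d.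
  by apply: coprimez_cong nd _; rewrite /coprimez gcd1z.
have n0 := coprimez_gt1_neq0 d_gt1 co_nd.
have [m md co_mn] := coprime_in_class d_gt1 co_ad n0.
apply: (mulfI (introN eqP fa_neq0)); rewrite mulr1 -{1}(f_const md) -f_mult //.
apply: f_const; have -> : m * n - a = m * (n - 1) + (m - a) by ring.
by rewrite rpredD // dvdz_mull.
Qed.

(** [f] takes inverse values at [n] and at an inverse of [n] modulo [d]; a
    common inverse prime to both integers links their values. *)
Lemma const_periodic (n n' : int) :
  coprimez n d -> (d %| n' - n)%Z -> f n' = f n.
Proof.
move=> co nn'; have co' := coprimez_cong nn' co.
have [r rn co_r] := inv_mod co.
have N0 : n * n' != 0.
  by rewrite mulf_neq0 //; apply: (coprimez_gt1_neq0 d_gt1).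
have [m mr] := coprime_in_class d_gt1 co_r N0.
rewrite coprimezMr => /andP[co_mn co_mn'].
have mn1 : (d %| m * n - 1)%Z.
  have -> : m * n - 1 = (m - r) * n + (r * n - 1) by ring.
  by rewrite rpredD // dvdz_mulr.
have mn'1 : (d %| m * n' - 1)%Z.
  have -> : m * n' - 1 = m * (n' - n) + (m * n - 1) by ring.
  by rewrite rpredD // dvdz_mull.
have e : f m * f n = 1 by rewrite -f_mult // const_one.
have e' : f m * f n' = 1 by rewrite -f_mult // const_one.
have fm0 : f m != 0.
  by apply: contra_eq_neq e => ->; rewrite mul0r eq_sym oner_neq0.
by apply: (mulfI fm0); rewrite e e'.
Qed.

(** For [m] odd in the class of [a], [f 2 * f m = f (m + m) = 2 * f m] gives
    [f 2 = 2].  If [d] is odd, periodicity propagates this to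
    [f (2 ^ k) = 2 ^ k], against [f (2 ^ k) = 1] at the exponent [k] of the
    theorem of Euler. *)
Lemma const_modulus_even : ~~ coprimez 2 d.
Proof.
apply/negP => co2.
have [m md] := coprime_in_class d_gt1 co_ad (isT : 2 != 0 :> int).
rewrite coprimez_sym => com.
have f2 : f 2 = 2.
  have : f (2 * m) = 2 * f m by rewrite !mulr_natl -[_ *+ 2]/(m + m) f_add.
  by rewrite f_mult // (f_const md) => /(mulIf (introN eqP fa_neq0)).
have co_pow k : coprimez (2 ^+ k) d by apply: coprimezXl.

(* [2 ^ k] itself is not prime to 2, but it is congruent to an odd [x]. *)
have pow k : f (2 ^+ k) = 2 ^+ k.
  elim: k => [|k IH].
    by rewrite !expr0 const_one // subrr dvdz0.
  have [x xk] := coprime_in_class d_gt1 (co_pow k) (isT : 2 != 0 :> int).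
  rewrite coprimez_sym => cox.
  have fx : f x = 2 ^+ k by rewrite (const_periodic (co_pow k) xk).
  rewrite [RHS]exprS -{1}f2 -fx -f_mult //; apply/esym/const_periodic => //.
  by rewrite exprS -mulrBr dvdz_mull.
pose k := totient (absz d).
have k0 : (0 < k)%N by rewrite totient_gt0; lia.
have : f (2 ^+ k) = 1.
  apply: const_one; rewrite -eqz_mod_dvd.
  have := Euler_exp_totient (co2 : coprime 2 (absz d)).
  rewrite -/k => e; have dE : d = absz d by lia.
  rewrite dE -[2]/(2%:R) -natrX -[1]/(1%:R) !natz !modz_nat; exact/eqP/congr1.
rewrite pow => /eqP; rewrite -natrX -[1]/(1%:R) eqr_nat => /eqP.
by case: k k0 => // k _; rewrite expnS; lia.
Qed.

End OneProgression.

(** * Combining two coprime moduli *)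

(** The element [1 + d * e] lies in the classes of [1] for both moduli, where the
    constant case for [e] would give it the value 1. *)
Lemma id_on_one_excludes_const (b d e : int) : 1 < d -> 1 < e -> coprimez b e ->
  f b <> 0 -> id_on_one d -> ~ const_on b e.
Proof.
move=> d1 e1 co fb fd cst.
have : f (1 + d * e) = 1.
  by apply: (const_one e1 co fb cst); rewrite addrAC subrr add0r dvdz_mull.
rewrite fd; last by rewrite addrAC subrr add0r dvdz_mulr.
move=> /eqP; rewrite -[1]/(1%:~R) eqr_int => /eqP; nia.
Qed.

(** The multiplier [m] is congruent to 1 modulo [e], so [f m] is known, and
    inverse to [n] modulo [d], so [f (m n)] is known. *)
Lemma id_on_coprime (d e n : int) : 1 < d -> 1 < e -> coprimez d e ->
  id_on_one d -> id_on_one e -> coprimez n d -> f n = n%:~R.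
Proof.
move=> d1 e1 co fd fe co_nd.
have n0 := coprimez_gt1_neq0 d1 co_nd.
have [r rn co_r] := inv_mod co_nd.
have [s [sd se]] := crt r 1 co.
have co_s : coprimez s (d * e).
  rewrite coprimezMr (coprimez_cong sd co_r) (coprimez_cong se) //.
  by rewrite /coprimez gcd1z.
have de1 : 1 < d * e by nia.
have [m ms co_mn] := coprime_in_class de1 co_s n0.
have me : (e %| m - 1)%Z.
  have -> : m - 1 = (m - s) + (s - 1) by ring.
  by rewrite rpredD //; apply: dvdz_trans _ ms; rewrite dvdz_mull.
have mn : (d %| m * n - 1)%Z.
  have -> : m * n - 1 = (m - s) * n + (s - r) * n + (r * n - 1) by ring.
  rewrite rpredD // rpredD ?dvdz_mulr //; apply: dvdz_trans _ ms; by rewrite dvdz_mulr.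
have m0 : m != 0.
  apply: (coprimez_gt1_neq0 e1); apply: coprimez_cong me _.
  by rewrite /coprimez gcd1z.
have := f_mult co_mn; rewrite fd // fe // intrM => /mulfI H.
by rewrite H ?intr_eq0.
Qed.

Lemma id_everywhere (d e : int) : 1 < d -> 1 < e -> coprimez d e ->
  id_on_one d -> id_on_one e -> forall n : int, f n = n%:~R.
Proof.
move=> d1 e1 co fd fe n.
have fdn := id_on_coprime d1 e1 co fd fe.
have co' : coprimez e d by rewrite coprimez_sym.
have fen := id_on_coprime e1 d1 co' fe fd.
have [->|n0] := eqVneq n 0.
  have fN1 : f (-1) = -1 by rewrite fdn // coprimeNz /coprimez gcd1z.
  have : f (0 * -1) = f 0 * f (-1) by apply: f_mult; rewrite coprimezN /coprimez gcdz1.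
  rewrite mul0r fN1 mulrN1 => /eqP; rewrite -addr_eq0 -mulr2n mulrn_eq0 /=.
  by move/eqP.
have [n1 [n2 [-> co2 co12 co1]]] := split_at_primes d1 n0.
by rewrite f_mult // fen ?fdn ?intrM // coprimez_sym; apply: co1.
Qed.

End MultiplicativeFunction.

Theorem corollary1 (R : realType) (f : int -> R[i])
    (f_mult : Defs.multiplicative f)
    (a b d1 d2 : int)
    (a_gt1 : 1 < a) (b_gt1 : 1 < b) (d1_gt1 : 1 < d1) (d2_gt1 : 1 < d2)
    (cop_a_d1 : coprimez a d1) (cop_b_d2 : coprimez b d2)
    (cop_d1_d2 : coprimez d1 d2)
    (fa_neq0 : f a <> 0) (fb_neq0 : f b <> 0)
    (f_add1 : forall u1 v1 : int,
       arith_prog a d1 u1 -> arith_prog a d1 v1 -> f (u1 + v1) = f u1 + f v1)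
    (f_add2 : forall u2 v2 : int,
       arith_prog b d2 u2 -> arith_prog b d2 v2 -> f (u2 + v2) = f u2 + f v2) :
  forall n : int, f n = n%:~R.
Proof.
have progP (x d n : int) : (d %| n - x)%Z -> arith_prog x d n.
  by move=> /dvdzP[q e]; exists q => //; rewrite -e; ring.
have add1 u v : (d1 %| u - a)%Z -> (d1 %| v - a)%Z -> f (u + v) = f u + f v.
  by move=> /progP ? /progP; apply: f_add1.
have add2 u v : (d2 %| u - b)%Z -> (d2 %| v - b)%Z -> f (u + v) = f u + f v.
  by move=> /progP ? /progP; apply: f_add2.
have [|not1] := id_or_const f_mult d1_gt1 cop_a_d1 add1.
  move=> id1; apply: (id_everywhere f_mult d1_gt1 d2_gt1 cop_d1_d2 id1).
  have [//|cst] := id_or_const f_mult d2_gt1 cop_b_d2 add2.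
  by case: (id_on_one_excludes_const f_mult d1_gt1 d2_gt1 cop_b_d2 fb_neq0 id1 cst).
have even1 := const_modulus_even f_mult d1_gt1 cop_a_d1 fa_neq0 add1 not1.
have [id2|not2] := id_or_const f_mult d2_gt1 cop_b_d2 add2.
  by case: (id_on_one_excludes_const f_mult d2_gt1 d1_gt1 cop_a_d1 fa_neq0 id2 not1).
have even2 := const_modulus_even f_mult d2_gt1 cop_b_d2 fb_neq0 add2 not2.
move: even1 even2 cop_d1_d2; rewrite !coprimezE !coprime2n => e1 e2.
rewrite /coprime => /eqP g.
have : (2 %| gcdn `|d1| `|d2|)%N by rewrite dvdn_gcd !dvdn2 e1 e2.
by rewrite g.
Qed.
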